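(* Let $\lambda,\beta>0$, let $1\le m\le n$, and let $\hat\rho=\frac{n\lambda}{m\beta}$. Let $\hat x_1,\dots,\hat x_m$ be a random sample of $m$ of the data points $x_1,\dots,x_n$, drawn uniformly at random without replacement, and let $\hat H=\hat\rho I+\frac1m\sum_{i=1}^m\hat x_i\hat x_i^\top$. For any $0<\delta\le 1/2$ and $t>0$, if $$m\ge\frac{2}{\delta^2}\bigl(\mu(\hat\rho)\gamma(C,\hat\rho)+1\bigr)(t+\log d),$$ then with probability at least $1-e^{-t}$, $$x_i^\top\hat H^{-1}x_i\le(1+2\delta)\,\mu(\hat\rho)\,\gamma(C,\hat\rho)\qquad\text{for all } i=1,\dots,n.$$
   Context: Data: $x_1,\dots,x_n\in\mathbb{R}^d$, not all zero; $C=\frac1n\sum_{i=1}^n x_ix_i^\top$. Let $X=(x_1,\dots,x_n)\in\mathbb{R}^{d\times n}$ with singular value decomposition $\frac{1}{\sqrt n}X=U\Sigma V^\top$, where $n\ge d$, $U\in\mathbb{R}^{d\times d}$ is orthogonal, $V\in\mathbb{R}^{n\times d}$ has orthonormal columns, $\Sigma=\mathrm{diag}(\sigma_1,\dots,\sigma_d)$, $\sigma_1\ge\dots\ge\sigma_d\ge0$. For $\rho>0$, the numerical rank is $\gamma(C,\rho)=\sum_{j=1}^d\frac{\sigma_j^2}{\sigma_j^2+\rho}$, and the generalized incoherence is $$\mu(\rho)=\max_{1\le i\le n}\frac{n}{\gamma(C,\rho)}\sum_{j=1}^d\frac{\sigma_j^2}{\sigma_j^2+\rho}V_{ij}^2 .$$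 *)

(* Defs.v *)
From HB Require Import structures.
From mathcomp Require Import all_boot all_order all_algebra.
From mathcomp Require Import all_classical all_reals all_analysis.

Set Implicit Arguments.
Unset Strict Implicit.
Unset Printing Implicit Defensive.

Import Order.TTheory GRing.Theory Num.Theory.

Local Open Scope classical_set_scope.
Local Open Scope ring_scope.

Section Definitions.
Variable R : realType.

Definition data_mx d n (x : 'I_n -> 'cV[R]_d) : 'M[R]_(d, n) :=
  \matrix_(k < d, i < n) x i k 0.

Record is_svd d n (A : 'M[R]_(d, n))
    (U : 'M[R]_d) (sigma : 'rV[R]_d) (V : 'M[R]_(n, d)) : Prop := IsSvd {
  svd_left_orthogonal : U^T *m U = 1%:M;
  svd_right_orthonormal : V^T *m V = 1%:M;
  svd_sorted : forall j k : 'I_d, (j <= k)%N -> sigma 0 k <= sigma 0 j;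
  svd_ge0 : forall j : 'I_d, 0 <= sigma 0 j;
  svd_factorization : A = U *m diag_mx sigma *m V^T }.

(* gamma(C, rho): if n^(-1/2) X = U Sigma V^T, then sigma_1^2, ..., sigma_d^2
   are the eigenvalues of C = n^-1 X X^T, so C enters only through sigma. *)
Definition numerical_rank d (sigma : 'rV[R]_d) (rho : R) : R :=
  \sum_(j < d) sigma 0 j ^+ 2 / (sigma 0 j ^+ 2 + rho).

(* The terms are nonnegative when rho > 0, so the default value 0 of the
   iterated maximum is harmless as soon as n > 0. *)
Definition incoherence d n (sigma : 'rV[R]_d) (V : 'M[R]_(n, d)) (rho : R) : R :=
  \big[Num.max/0]_(i < n)
    (n%:R / numerical_rank sigma rho *
     \sum_(j < d) sigma 0 j ^+ 2 / (sigma 0 j ^+ 2 + rho) * V i j ^+ 2).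

Definition sample_hessian d m (rho : R) (y : 'I_m -> 'cV[R]_d) : 'M[R]_d :=
  rho%:M + m%:R^-1 *: \sum_(k < m) y k *m (y k)^T.

(* The random element S w = (s_1, ..., s_m) is an ordered uniform sample without
   replacement of m indices out of n. Each of the n ^_ m injective index
   sequences has probability 1 / n ^_ m, hence the non-injective ones have
   total probability 0 when m <= n. *)
Definition uniform_sample_without_replacement (disp : measure_display)
    (T : measurableType disp) (P : probability T R) m n
    (S : T -> {ffun 'I_m -> 'I_n}) : Prop :=
  (forall f : {ffun 'I_m -> 'I_n}, measurable [set w | S w = f]) /\
  (forall f : {ffun 'I_m -> 'I_n}, injective f ->
     P [set w | S w = f] = ((n ^_ m)%:R^-1)%:E).

End Definitions.

(* Main.v *)
Require Import Defs.
From HB Require Import structures.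
From mathcomp Require Import all_boot all_order all_algebra.
From mathcomp Require Import all_classical all_reals all_analysis.
From mathcomp Require Import ring lra zify.

Set Implicit Arguments.
Unset Strict Implicit.
Unset Printing Implicit Defensive.

Import Order.TTheory GRing.Theory Num.Theory.

Local Open Scope ring_scope.

(** Let [rho] be the regularization, [L = mu gamma], [H = C + rho I] and
    [G = U diag (sigma_j^2 + rho)^(-1/2)], so that [G^T H G = I].  The matrices
    [Y_i = G^T (x_i x_i^T + rho I) G] have mean [I]; they are positive
    semidefinite, and [Y_i <= (L + 1) I] because [rho G^T G <= I] and the
    leverage score [|G^T x_i|^2 = x_i^T H^-1 x_i] is at most [L]
    ([leverage_le_incoherence]).
    Conjugation by [G] turns the sampled Hessian into the mean of the sampled
    [Y_i].  If the smallest eigenvalue of that mean is at least [1 - delta],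
    then every [x_i^T Hhat^-1 x_i] is at most
    [L / (1 - delta) <= (1 + 2 delta) L] ([quad_invmx_le]).  It remains to show
    that a sum of [m] of the [Y_i], drawn without replacement, has an
    eigenvalue below [(1 - delta) m] with probability at most
    [d exp (- m delta^2 / (2 (L + 1)))] ([matrix_chernoff_lower_tail]).

    The usual proof of such a bound follows [tr exp (- theta S)] along the
    partial sums [S] by means of the Golden-Thompson inequality.  Here the
    exponential is replaced by a high power: the potential of a partial sum [S]
    is [tr (K - S)^N] with [K = N / theta], which is [K^N tr exp (- theta S)] up
    to a factor that tends to [1] as [N] grows.  All estimates then come from
    polynomial identities and from the positivity of [tr (P Q)] for positive
    semidefinite [P] and [Q] ([psd_tr_mul_ge0]).  Three facts carry the
    argument.

    - A difference [tr B^(n+1) - tr A^(n+1)] is the sum of the [n + 1] numbers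
      [tr ((B - A) B^j A^(n-j))].  For positive semidefinite [A] and [B] these
      are nondecreasing in [j], with increments
      [tr ((B - A) B^j (B - A) A^(n-1-j))].  Nonnegative increments give the
      convexity of [tr A^(n+1)] ([tr_exp_gradient_le]), and an upper bound on
      the increments gives a second-order estimate for one step of the sampling
      ([tr_exp_sub_le]).
    - The second-order estimate, averaged over a uniform index, shows that one
      more draw multiplies the mean potential by at most
      [1 - theta (1 - theta (L + 1) / 2)], up to an error that vanishes as [N]
      grows ([potential_average]).
    - Convexity shows that a fresh draw yields a mean potential no larger than
      an independent uniform draw does ([without_replacement_step]).  Hence the
      second fact can be iterated along samples without replacement.

    Markov's inequality with [theta = delta / (L + 1)], followed by the limit
    in [N], gives the tail bound. *)

(** * Positive semidefinite matrices and traces of their powers *)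

Section Psd.
Variable R : realFieldType.

(** The quadratic form is written as a trace so that cyclicity of the trace
    applies to it directly. *)
Definition psd d (A : 'M[R]_d) : Prop :=
  A^T = A /\ forall v : 'cV[R]_d, 0 <= \tr (v^T *m A *m v).

Lemma psdD d (A B : 'M[R]_d) : psd A -> psd B -> psd (A + B).
Proof.
move=> [sA pA] [sB pB]; split=> [|v]; first by rewrite linearD /= sA sB.
by rewrite mulmxDr mulmxDl mxtraceD addr_ge0 ?pA ?pB.
Qed.

Lemma psdZ d c (A : 'M[R]_d) : 0 <= c -> psd A -> psd (c *: A).
Proof.
move=> c0 [sA pA]; split=> [|v]; first by rewrite linearZ /= sA.
by rewrite -scalemxAr -scalemxAl mxtraceZ mulr_ge0 ?pA.
Qed.

Lemma tr_col_sqr d (v : 'cV[R]_d) : \tr (v^T *m v) = \sum_i v i 0 ^+ 2.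
Proof.
by rewrite /mxtrace big_ord1 mxE; apply: eq_bigr => i _; rewrite mxE expr2.
Qed.

Lemma tr_mulT_ge0 d k (W : 'M[R]_(d, k)) : 0 <= \tr (W^T *m W).
Proof.
apply: sumr_ge0 => i _; rewrite mxE; apply: sumr_ge0 => j _.
by rewrite mxE -expr2 sqr_ge0.
Qed.

Lemma psd_scalar d c : 0 <= c -> psd (c%:M : 'M[R]_d).
Proof.
move=> c0; rewrite -scalemx1; apply: psdZ => //; split=> [|v].
  by rewrite trmx1.
by rewrite mulmx1 tr_mulT_ge0.
Qed.

Lemma psd_sum d I (s : seq I) (p : pred I) (F : I -> 'M[R]_d) :
  (forall i, p i -> psd (F i)) -> psd (\sum_(i <- s | p i) F i).
Proof.
move=> pF; elim/big_ind: _ => //; last exact: psdD.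
by rewrite -[0](raddf0 (@scalar_mx R d)); apply: psd_scalar.
Qed.

Lemma psd_congr d k (A : 'M[R]_d) (W : 'M[R]_(d, k)) :
  psd A -> psd (W^T *m A *m W).
Proof.
move=> [sA pA]; split=> [|v]; first by rewrite !trmx_mul trmxK sA mulmxA.
by have := pA (W *m v); rewrite trmx_mul !mulmxA.
Qed.

Lemma psd_conj d (A X : 'M[R]_d) : X^T = X -> psd A -> psd (X * A * X).
Proof. by move=> sX /(psd_congr X); rewrite sX. Qed.

Lemma psd_exp d (A : 'M[R]_d) k : psd A -> psd (A ^+ k).
Proof.
move=> pA; have sA := pA.1.
elim/ltn_ind: k => -[|[|k]] IH //; first exact: psd_scalar.
rewrite exprSr exprS; apply: psd_conj => //; exact: IH.
Qed.

Lemma tr_mx11_mul (M N : 'M[R]_1) : \tr (M *m N) = \tr M * \tr N.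
Proof. by rewrite /mxtrace !big_ord1 mxE big_ord1. Qed.

Lemma psd_cauchy_schwarz d (P : 'M[R]_d) (u v : 'cV[R]_d) : psd P ->
  \tr (u^T *m P *m v) ^+ 2 <= \tr (u^T *m P *m u) * \tr (v^T *m P *m v).
Proof.
move=> [sP pP].
set a := \tr (u^T *m P *m u); set b := \tr (u^T *m P *m v).
set c := \tr (v^T *m P *m v).
have b' : \tr (v^T *m P *m u) = b.
  by rewrite -mxtrace_tr !trmx_mul trmxK sP mulmxA.
have Q x y : 0 <= x ^+ 2 * a + 2 * x * y * b + y ^+ 2 * c.
  suff -> : x ^+ 2 * a + 2 * x * y * b + y ^+ 2 * c =
      \tr ((x *: u + y *: v)^T *m P *m (x *: u + y *: v)) by exact: pP.
  have -> : (x *: u + y *: v)^T = x *: u^T + y *: v^T.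
    by rewrite linearD !linearZ.
  rewrite !mulmxDl !mulmxDr -!scalemxAl -!scalemxAr.
  by rewrite !mxtraceD !mxtraceZ -/a b' -/b -/c; ring.
have a0 : 0 <= a := pP u.
have : 0 <= c := pP v; rewrite le_eqVlt => /orP[/eqP c0|c0].
  (* A null vector [v] of the form pairs to zero with every [u]: otherwise a
     large multiple of [v] would make the form negative. *)
  have [->|bn0] := eqVneq b 0; first by rewrite expr0n mulr_ge0 // -c0.
  have := Q 1 (- (a + 1) / b); rewrite -c0.
  have -> : 1 ^+ 2 * a + 2 * 1 * (- (a + 1) / b) * b + (- (a + 1) / b) ^+ 2 * 0
     = - a - 2 by field.
  by lra.
(* The minimum of the form on the line [u + R v], cleared of denominators. *)
have := Q c (- b).
have -> : c ^+ 2 * a + 2 * c * (- b) * b + (- b) ^+ 2 * c = c * (a * c - b ^+ 2).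
  by ring.
by rewrite pmulr_rge0 // subr_ge0.
Qed.

Lemma tr_delta d (P : 'M[R]_d) i j :
  \tr ((delta_mx i 0 : 'cV[R]_d)^T *m P *m (delta_mx j 0 : 'cV[R]_d)) = P i j.
Proof.
rewrite -mxtrace_tr /mxtrace big_ord1 mxE trmx_delta -rowE -colE.
by rewrite !mxE.
Qed.

(** Subtracting [w w^T / P_ii], where [w] is the [i]-th column of [P], keeps [P]
    positive semidefinite (this is Cauchy-Schwarz for the form of [P]) and
    clears its [i]-th row.  The removed term contributes [w^T Q w / P_ii >= 0]
    to the trace, so one can induct on the number of nonzero diagonal
    entries. *)
Lemma psd_tr_mul_ge0 d (P Q : 'M[R]_d) : psd P -> psd Q -> 0 <= \tr (P * Q).
Proof.
move=> pP pQ.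
have [k] := ubnP #|[set i | P i i != 0]|; elim: k P pP => // k IH P pP.
rewrite ltnS => lek; have [sP posP] := pP.
have cs i j : P i j ^+ 2 <= P i i * P j j.
  have := psd_cauchy_schwarz (delta_mx i 0) (delta_mx j 0) pP.
  by rewrite !tr_delta.
case: (set_0Vmem [set i | P i i != 0]) => [P0|[i]].
  suff -> : P = 0 by rewrite mul0r mxtrace0.
  apply/matrixP => i j; rewrite mxE; apply/eqP.
  have /setP/(_ i) := P0; rewrite !inE => /negbFE/eqP Pi0.
  have := cs i j; rewrite Pi0 mul0r => le0.
  by rewrite -sqrf_eq0 eq_le le0 sqr_ge0.
rewrite inE => Pi0.
have Pi_gt0 : 0 < P i i.
  by rewrite lt_def Pi0 -tr_delta posP.
set w := col i P; set P1 := P - (P i i)^-1 *: (w *m w^T).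
have Pe : P *m delta_mx i 0 = w by rewrite -colE.
have pP1 : psd P1.
  split=> [|v].
    by rewrite linearB linearZ /= trmx_mul trmxK sP.
  rewrite mulmxBr mulmxBl linearB /= -scalemxAr -scalemxAl linearZ /=.
  have -> : \tr (v^T *m (w *m w^T) *m v) = \tr (v^T *m P *m delta_mx i 0) ^+ 2.
    rewrite -[v^T *m P *m _]mulmxA Pe mulmxA -[_ *m w^T *m v]mulmxA.
    rewrite tr_mx11_mul expr2; congr (_ * _).
    by rewrite -mxtrace_tr trmx_mul trmxK.
  rewrite subr_ge0 mulrC ler_pdivrMr //.
  by have := psd_cauchy_schwarz v (delta_mx i 0) pP; rewrite tr_delta.
have -> : P = P1 + (P i i)^-1 *: (w *m w^T) by rewrite subrK.
rewrite mulrDl linearD /= addr_ge0 //.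
  apply: IH => //; apply: leq_trans lek; apply: proper_card.
  apply/properP; split; last first.
    exists i; rewrite !inE // negbK !mxE /= big_ord1 !mxE.
    by apply/eqP; field.
  apply/fintype.subsetP => j; rewrite !inE; apply: contra => /eqP Pj0.
  have Pji : P j i = 0.
    apply/eqP; have := cs j i; rewrite Pj0 mul0r => le0.
    by rewrite -sqrf_eq0 eq_le le0 sqr_ge0.
  by rewrite !mxE Pj0 big_ord1 !mxE Pji mul0r mulr0 subr0.
rewrite -mulmxE -scalemxAl mxtraceZ mulr_ge0 ?invr_ge0 ?(ltW Pi_gt0) //.
by rewrite -mulmxA mxtrace_mulC; apply: pQ.2.
Qed.

Lemma tr_mixed_ge0 d (A B W : 'M[R]_d) p r : psd A -> psd B ->
  0 <= \tr (W^T * B ^+ p * W * A ^+ r).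
Proof.
move=> pA pB; apply: psd_tr_mul_ge0; last exact: psd_exp.
exact: (psd_congr W (psd_exp p pB)).
Qed.

(** A convex sequence that exceeds both of its end values would have to keep
    growing once it has started to. *)
Lemma convex_seq_le (f : nat -> R) n F :
  (forall p, (p.+2 <= n)%N -> 2 * f p.+1 <= f p + f p.+2) ->
  f 0 <= F -> f n <= F -> forall p, (p <= n)%N -> f p <= F.
Proof.
move=> cvx f0 fn p lepn; rewrite leNgt; apply/negP => Fp.
have up q : (q < n)%N -> F < f q.+1 -> f q < f q.+1.
  elim: q => [_|q IH ltqn Fq]; first exact: le_lt_trans f0.
  have := cvx q ltqn; case: (ltP F (f q.+1)) => [h|]; last by lra.
  have := IH (ltnW ltqn) h; lra.
have : F < f n.
  elim: n lepn cvx up {fn} => [|n IH]; first by rewrite leqn0 => /eqP <-.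
  rewrite leq_eqVlt => /predU1P[<- //|]; rewrite ltnS => lepn cvx up.
  have Fn : F < f n.
    by apply: IH => // q ltqn; [apply: cvx|apply: up]; apply: ltnW.
  case: n lepn cvx up Fn {IH} => [_ _ _|n _ cvx up Fn]; first by lra.
  have := up n (leqnSn _) Fn; have := cvx n (leqnn _); lra.
by lra.
Qed.

(** The left-hand side is a convex function of [p], hence bounded by its two end
    values: its second difference is [tr (W^T B^p W A^(n-p-2))] for
    [W = B Y - Y A]. *)
Lemma tr_mixed_le d (A B Y : 'M[R]_d) n F : psd A -> psd B -> Y^T = Y ->
  Y = B - A ->
  \tr (Y * Y * A ^+ n) <= F -> \tr (Y * Y * B ^+ n) <= F ->
  forall p, (p <= n)%N -> \tr (Y * B ^+ p * Y * A ^+ (n - p)) <= F.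
Proof.
move=> pA pB sY YE F0 Fn.
apply: (convex_seq_le (f := fun p => \tr (Y * B ^+ p * Y * A ^+ (n - p)))).
- move=> p ltpn; rewrite -subr_ge0.
  have {ltpn} [k ->] : exists k, n = (p + k.+2)%N.
    by exists (n - p.+2)%N; lia.
  have -> : (p + k.+2 - p = k.+2)%N by lia.
  have -> : (p + k.+2 - p.+1 = k.+1)%N by lia.
  have -> : (p + k.+2 - p.+2 = k)%N by lia.
  have := tr_mixed_ge0 (B * Y - Y * A) p k pA pB.
  set l := \tr _; set r := (X in _ -> 0 <= X); suff -> : l = r by [].
  rewrite /l /r.
  have -> : (B * Y - Y * A)^T = Y * B - A * Y.
    by rewrite linearB /= -!mulmxE !trmx_mul sY pA.1 pB.1.
  rewrite !(mulrBl, mulrBr) !linearB /=.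
  have -> : \tr (Y * B * B ^+ p * (B * Y) * A ^+ k) =
            \tr (Y * B ^+ p.+2 * Y * A ^+ k).
    by rewrite exprS exprSr !mulrA.
  have -> : \tr (Y * B * B ^+ p * (Y * A) * A ^+ k) =
            \tr (Y * B ^+ p.+1 * Y * A ^+ k.+1).
    by rewrite !exprS !mulrA.
  have -> : \tr (A * Y * B ^+ p * (B * Y) * A ^+ k) =
            \tr (Y * B ^+ p.+1 * Y * A ^+ k.+1).
    by rewrite -!mulrA -[in LHS]mulmxE mxtrace_mulC mulmxE !exprSr !mulrA.
  have -> : \tr (A * Y * B ^+ p * (Y * A) * A ^+ k) =
            \tr (Y * B ^+ p * Y * A ^+ k.+2).
    by rewrite -!mulrA -[in LHS]mulmxE mxtrace_mulC mulmxE exprS exprSr !mulrA.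
  by ring.
- by rewrite expr0 mulr1 subn0.
- rewrite subnn expr0 mulr1 -mulrA -mulmxE mxtrace_mulC mulmxE.
  by rewrite -mulrA -mulmxE mxtrace_mulC mulmxE.
Qed.

Section TrExpDifference.
Variables (d : nat) (A B : 'M[R]_d).

(** The traces [tr (B^j A^(n+1-j))] interpolate between the two powers. *)
Lemma tr_exp_telescope n :
  \tr (B ^+ n.+1) - \tr (A ^+ n.+1) =
  \sum_(0 <= j < n.+1) \tr ((B - A) * B ^+ j * A ^+ (n - j)).
Proof.
pose u j := \tr (B ^+ j * A ^+ (n.+1 - j)).
have -> : \tr (B ^+ n.+1) - \tr (A ^+ n.+1) = u n.+1 - u 0.
  by rewrite /u subnn subn0 !expr0 mulr1 mul1r.
rewrite -telescope_sumr //; apply: eq_big_nat => j /andP[_ ltjn].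
rewrite /u !mulrBl linearB /= -exprS subSS; congr (_ - _).
by rewrite -[in RHS]mulrA -mulmxE [RHS]mxtrace_mulC mulmxE -mulrA -exprSr subSn.
Qed.

Lemma tr_exp_increment n j : (j < n)%N ->
  \tr ((B - A) * B ^+ j.+1 * A ^+ (n - j.+1)) -
  \tr ((B - A) * B ^+ j * A ^+ (n - j)) =
  \tr ((B - A) * B ^+ j * (B - A) * A ^+ (n.-1 - j)).
Proof.
move=> ltjn; have -> : (n - j.+1 = n.-1 - j)%N by lia.
have -> : (n - j = (n.-1 - j).+1)%N by lia.
set Y := B - A; rewrite -raddfB /= exprSr exprS; congr (\tr _).
by rewrite mulrA [Y * B ^+ j * (A * _)]mulrA -mulrBl -mulrBr.
Qed.

(** The terms of the telescoping sum decrease by at most [F] at each step from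
    [j = n] down to [j = 0], which costs [F] times [0 + 1 + ... + n]. *)
Lemma tr_exp_second_order_le n (F : R) :
  (forall p, (p < n)%N ->
     \tr ((B - A) * B ^+ p * (B - A) * A ^+ (n.-1 - p)) <= F) ->
  n.+1%:R * \tr ((B - A) * B ^+ n) - n.+1%:R * n%:R / 2 * F <=
  \tr (B ^+ n.+1) - \tr (A ^+ n.+1).
Proof.
move=> leF; rewrite tr_exp_telescope.
have lower j : (j <= n)%N -> \tr ((B - A) * B ^+ n) - (n - j)%:R * F <=
    \tr ((B - A) * B ^+ j * A ^+ (n - j)).
  elim: {j}(n - j)%N {-2}j (erefl (n - j)%N) => [|k IH] j njk lejn.
    have -> : j = n by lia.
    by rewrite subnn mul0r subr0 expr0 mulr1.
  have ltjn : (j < n)%N by lia.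
  have := IH j.+1 ltac:(lia) ltjn; have := tr_exp_increment ltjn.
  have := leF j ltjn; have -> : (n - j = (n - j.+1).+1)%N by lia.
  have -> : (n - j.+1).+1%:R * F = (n - j.+1)%:R * F + F.
    by rewrite -natr1 mulrDl mul1r.
  lra.
suff -> : n.+1%:R * \tr ((B - A) * B ^+ n) - n.+1%:R * n%:R / 2 * F =
    \sum_(0 <= j < n.+1) (\tr ((B - A) * B ^+ n) - (n - j)%:R * F).
  by apply: ler_sum_nat => j /andP[_]; rewrite ltnS; apply: lower.
rewrite sumrB sumr_const_nat subn0 -[\tr _ *+ _]mulr_natl -mulr_suml.
congr (_ - _ * _); rewrite -natr_sum big_nat_rev /=.
rewrite (eq_big_nat _ _ (F2 := id)); last by move=> i /andP[_ lti] /=; lia.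
suff E : (n.+1 * n = (\sum_(0 <= i < n.+1) i) * 2)%N.
  by rewrite -natrM E natrM mulfK ?pnatr_eq0.
by elim: (n) => [|k IH]; [rewrite big_nat1|rewrite big_nat_recr //=; nia].
Qed.

Hypotheses (pA : psd A) (pB : psd B).

Let sBA : (B - A)^T = B - A.
Proof. by rewrite linearB /= pA.1 pB.1. Qed.

Lemma tr_exp_increment_ge0 n j : (j < n)%N ->
  \tr ((B - A) * B ^+ j * A ^+ (n - j)) <=
  \tr ((B - A) * B ^+ j.+1 * A ^+ (n - j.+1)).
Proof.
move=> ltjn; rewrite -subr_ge0 tr_exp_increment // -[in X in X * _ * _]sBA.
exact: tr_mixed_ge0.
Qed.

Lemma tr_exp_profile_le n i j : (i <= j <= n)%N ->
  \tr ((B - A) * B ^+ i * A ^+ (n - i)) <=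
  \tr ((B - A) * B ^+ j * A ^+ (n - j)).
Proof.
case/andP=> leij; elim: j leij => [|j IH].
  by rewrite leqn0 => /eqP ->.
rewrite leq_eqVlt => /predU1P[-> //|]; rewrite ltnS => leij ltjn.
apply: le_trans (IH leij (ltnW ltjn)) _; exact: tr_exp_increment_ge0.
Qed.

Lemma tr_mul_exp_le n : \tr ((B - A) * A ^+ n) <= \tr ((B - A) * B ^+ n).
Proof.
have := @tr_exp_profile_le n 0 n (leqnn n).
by rewrite subn0 subnn !expr0 !mulr1.
Qed.

(** This is convexity of [tr A^(n+1)] on the positive semidefinite cone, in
    the form of a supporting hyperplane at [A]. *)
Lemma tr_exp_gradient_le n :
  n.+1%:R * \tr ((B - A) * A ^+ n) <= \tr (B ^+ n.+1) - \tr (A ^+ n.+1).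
Proof.
rewrite tr_exp_telescope mulr_natl -[in X in _ *+ X](subn0 n.+1) -sumr_const_nat.
apply: ler_sum_nat => j /andP[_ ltjn].
have := @tr_exp_profile_le n 0 j; rewrite expr0 subn0 mulr1; apply.
exact: ltjn.
Qed.

End TrExpDifference.

(** With [E = A - b I], each factor [A = b I + E] expands into terms
    [b^i E^j] with [b >= 0], and powers of [E] are positive semidefinite. *)
Lemma psd_shift_mul_exp d (A : 'M[R]_d) (b : R) k : 0 <= b -> psd (A - b%:M) ->
  psd ((A - b%:M) * A ^+ k).
Proof.
move=> b0 pE; set E := A - b%:M.
suff H i : psd (E ^+ i * A ^+ k) by have := H 1%N; rewrite expr1.
have AE : A = b%:M + E by rewrite addrC subrK.
elim: k i => [|k IH] i; first by rewrite expr0 mulr1; apply: psd_exp.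
have -> : E ^+ i * A ^+ k.+1 = b *: (E ^+ i * A ^+ k) + E ^+ i.+1 * A ^+ k.
  rewrite [in LHS]exprS [in X in X * (_ ^+ _)]AE.
  rewrite mulrDl mulrDr exprSr [X in _ + X]mulrA.
  congr (_ + _).
  by rewrite -mul_scalar_mx -!mulmxE; rewrite mulmxA scalar_mxC -!mulmxA.
exact: psdD (psdZ b0 (IH i)) (IH i.+1).
Qed.

(** [l Y - Y^2 = Y Z = Z Y] with [Z = l I - Y], and
    [l Y Z = Y Z Y + Z Y Z] because [Y + Z = l I]. *)
Lemma psd_scale_sub_sqr d (Y : 'M[R]_d) (l : R) :
  0 < l -> psd Y -> psd (l%:M - Y) -> psd (l *: Y - Y * Y).
Proof.
move=> l0 pY pZ; set Z := l%:M - Y.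
have sZ : Z^T = Z := pZ.1.
have ZY : Z * Y = l *: Y - Y * Y by rewrite mulrBl -mulmxE mul_scalar_mx.
have YZ : Y * Z = l *: Y - Y * Y.
  by rewrite mulrBr -mulmxE scalar_mxC mul_scalar_mx.
suff -> : l *: Y - Y * Y = l^-1 *: (Y * Z * Y + Z * Y * Z).
  apply: psdZ; first by rewrite invr_ge0 ltW.
  by apply: psdD; apply: psd_conj => //; apply: pY.1.
rewrite ZY YZ -mulrDr /Z addrCA subrr addr0 -mulmxE scalar_mxC mul_scalar_mx.
by rewrite scalerA mulVf ?scale1r // gt_eqF.
Qed.

(** The first-order term of [tr (B - Y)^(n+1)] is [- (n+1) tr (Y B^n)].  The
    second-order terms [tr (Y B^p Y A^(n-1-p))], where [A = B - Y], are at most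
    [l / b] times [tr (Y B^n)]: one factor [Y] is traded for [l] and the
    missing power of [A] or [B] for [1 / b]. *)
Lemma tr_exp_sub_le d (B Y : 'M[R]_d) n (l b : R) : 0 < l -> 0 < b ->
  psd Y -> psd (l%:M - Y) -> psd (B - Y - b%:M) ->
  \tr ((B - Y) ^+ n.+1) <=
  \tr (B ^+ n.+1) - n.+1%:R * (1 - n%:R * l / (2 * b)) * \tr (Y * B ^+ n).
Proof.
move=> l0 b0 pY plY pE; set A := B - Y.
have pb : psd (b%:M : 'M[R]_d) by apply: psd_scalar; apply: ltW.
have pA : psd A by have := psdD pE pb; rewrite subrK.
have BE : B = A + Y by rewrite subrK.
have pB : psd B by rewrite BE; apply: psdD.
have pEB : psd (B - b%:M) by have := psdD pE pY; rewrite addrAC subrK.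
have YE : Y = B - A by rewrite BE addrAC subrr add0r.
set G := \tr (Y * B ^+ n).
case: n @G => [|n] G.
  by rewrite !expr1 /G expr0 mulr1 mul0r mul0r subr0 mul1r mul1r linearB.
have sq M k : psd M -> psd (M - b%:M) ->
    \tr (Y * Y * M ^+ k) <= l / b * \tr (Y * M ^+ k.+1).
  move=> pM pMb.
  have := psd_tr_mul_ge0 (psd_scale_sub_sqr l0 pY plY) (psd_exp k pM).
  rewrite mulrBl linearB /= subr_ge0 => /le_trans; apply.
  rewrite -mulmxE -scalemxAl mxtraceZ mulmxE -mulrA ler_pM2l // mulrC.
  rewrite ler_pdivlMr // mulrC.
  have := psd_tr_mul_ge0 pY (psd_shift_mul_exp k (ltW b0) pMb).
  rewrite mulrBl mulrBr linearB /= subr_ge0 -exprS; congr (_ <= _).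
  by rewrite -[in LHS]mulmxE mul_scalar_mx -scalemxAr mxtraceZ.
have F2 : \tr (Y * Y * B ^+ n) <= l / b * G by apply: sq.
have F1 : \tr (Y * Y * A ^+ n) <= l / b * G.
  apply: le_trans (sq A n pA pE) _; rewrite ler_pM2l ?divr_gt0 //.
  rewrite /G [X in \tr (X * _)]YE [X in _ <= \tr (X * _)]YE.
  exact: tr_mul_exp_le.
have := @tr_exp_second_order_le d A B n.+1 (l / b * G).
rewrite -YE -/G => H.
have : n.+2%:R * G - n.+2%:R * n.+1%:R / 2 * (l / b * G)
       <= \tr (B ^+ n.+2) - \tr (A ^+ n.+2).
  by apply: H => p ltpn; apply: (tr_mixed_le pA pB pY.1 YE F1 F2).
have -> : n.+2%:R * G - n.+2%:R * n.+1%:R / 2 * (l / b * G) =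
   n.+2%:R * (1 - n.+1%:R * l / (2 * b)) * G by field; rewrite gt_eqF.
lra.
Qed.

(** The supporting hyperplane at [A = u v v^T / |v|^2], for which
    [tr A^k = u^k], lies below [tr B^k].  For [k >= 2] the normal [A^(k-1)] of
    this hyperplane is a multiple of [v v^T]. *)
Lemma tr_exp_ge d (B : 'M[R]_d) (u : R) (v : 'cV[R]_d) n : psd B -> 0 <= u ->
  v != 0 -> u * \tr (v^T *m v) <= \tr (v^T *m B *m v) ->
  u ^+ n.+2 <= \tr (B ^+ n.+2).
Proof.
move=> pB u0 vn0 uv.
have v0 : 0 < \tr (v^T *m v).
  rewrite lt_def tr_mulT_ge0 andbT tr_col_sqr psumr_neq0; last first.
    by move=> i _; rewrite sqr_ge0.
  have [i vi] : exists i, v i 0 != 0.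
    apply/existsP; apply: contraNT vn0 => /existsPn v0.
    by apply/eqP/colP => i; rewrite mxE; apply/eqP; have := v0 i; rewrite negbK.
  by apply/hasP; exists i; rewrite ?mem_index_enum //= lt_def sqr_ge0 sqrf_eq0 vi.
set s := \tr (v^T *m v) in uv v0.
pose Q : 'M[R]_d := s^-1 *: (v *m v^T); pose A : 'M[R]_d := u *: Q.
have vv : v^T *m v = s%:M by rewrite [LHS]mx11_scalar /s trace_mx11.
have QQ : Q * Q = Q.
  rewrite /Q -mulmxE -scalemxAl -scalemxAr scalerA -mulmxA [v^T *m _]mulmxA vv.
  rewrite mul_scalar_mx -scalemxAr scalerA; congr (_ *: _).
  by field; exact: lt0r_neq0.
have trQ : \tr Q = 1 by rewrite mxtraceZ mxtrace_mulC -/s mulVf ?gt_eqF.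
have AE k : A ^+ k.+1 = u ^+ k.+1 *: Q.
  elim: k => [|k IH]; first by rewrite !expr1.
  by rewrite exprS IH -mulmxE -scalemxAl -scalemxAr scalerA mulmxE QQ -exprS.
have pA : psd A.
  apply: psdZ => //; apply: psdZ; first by rewrite invr_ge0 ltW.
  have := psd_congr v^T (psd_scalar 1 ler01); rewrite trmxK mulmx1; apply.
have trQM (M : 'M[R]_d) : \tr (M * Q) = \tr (v^T *m M *m v) / s.
  by rewrite -mulmxE -scalemxAr mxtraceZ mulmxA mxtrace_mulC mulmxA mulrC.
have := tr_exp_gradient_le pA pB n.+1.
have -> : \tr (A ^+ n.+2) = u ^+ n.+2 by rewrite AE mxtraceZ trQ mulr1.
suff : 0 <= \tr ((B - A) * A ^+ n.+1).
  move=> h; have : 0 <= n.+2%:R * \tr ((B - A) * A ^+ n.+1) by rewrite mulr_ge0.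
  lra.
rewrite AE -mulmxE -scalemxAr mxtraceZ mulr_ge0 ?exprn_ge0 //.
rewrite mulmxE mulrBl linearB /= subr_ge0 -{1}[A]expr1 AE.
rewrite -mulmxE -scalemxAl mulmxE QQ mxtraceZ trQ mulr1 trQM ler_pdivlMr //.
Qed.

End Psd.

(** * Comparison of draws with and without replacement *)

Section WithoutReplacement.
Variables (R : realFieldType) (I : finType).

(** A set with a point outside of it is the same datum as a larger set with
    a point in it. *)
Lemma sum_insert_delete (m : nat) (G : {set I} -> I -> R) :
  \sum_(P : {set I} | #|P| == m) \sum_(j | j \notin P) G P j =
  \sum_(Q : {set I} | #|Q| == m.+1) \sum_(j in Q) G (Q :\ j) j.
Proof.
rewrite !pair_big_dep /=.
rewrite (reindex_onto (fun u => (u.1 :\ u.2, u.2)) (fun u => (u.2 |: u.1, u.2))).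
  apply: eq_bigl => -[Q j] /=; rewrite !inE eqxx /=.
  have [jQ|njQ] := boolP (j \in Q).
    rewrite finset.setD1K // eqxx andbT andbT.
    by rewrite [in RHS](cardsD1 j) jQ add1n eqSS !andbT.
  rewrite andbF; apply/negbTE; rewrite negb_and orbC; apply/orP; left.
  by apply: contra njQ => /eqP [<-]; rewrite finset.setU11.
by move=> [P j] /= /andP[_ jP]; rewrite finset.setU1K.
Qed.

(** An independent uniform draw after the sample [P] hits an index outside [P]
    with probability [1 - m / n], and then acts as a fresh draw.  Otherwise it
    repeats some [i] in [P]; adding a fresh [j] to [P] gives a uniform set [Q]
    of size [m + 1], and the repeated sum is the sum over [Q] with [X j]
    exchanged for [X i].  The exchanges average to the sum over [Q], so
    Jensen's inequality, which is the hypothesis, bounds the repeated case from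
    below by the fresh one. *)
Lemma without_replacement_step (V : zmodType) (X : I -> V) (F : V -> R) m :
  (m < #|I|)%N ->
  (forall Q : {set I}, #|Q| = m.+1 ->
     (m.+1 * m)%:R * F (\sum_(i in Q) X i) <=
     \sum_(j in Q) \sum_(i in Q :\ j) F (\sum_(i in Q :\ j) X i + X i)) ->
  (m.+1 * #|I|)%:R * \sum_(Q : {set I} | #|Q| == m.+1) F (\sum_(i in Q) X i) <=
  (#|I| - m)%:R *
    \sum_(P : {set I} | #|P| == m) \sum_i F (\sum_(i in P) X i + X i).
Proof.
move=> ltmn jensen; set a := \sum_(Q | _) F _; set n := #|I| in ltmn *.
pose S (P : {set I}) := \sum_(i in P) X i.
have fresh : \sum_(P : {set I} | #|P| == m) \sum_(j | j \notin P) F (S P + X j) =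
    m.+1%:R * a.
  rewrite sum_insert_delete mulr_sumr; apply: eq_bigr => Q /eqP cQ.
  rewrite mulr_natl -cQ -sumr_const; apply: eq_bigr => j jQ.
  by rewrite /S [in RHS](big_setD1 j) //= addrC.
have repeated : (m.+1 * m)%:R * a <=
    (n - m)%:R * \sum_(P : {set I} | #|P| == m) \sum_(i in P) F (S P + X i).
  have -> :
      (n - m)%:R * \sum_(P : {set I} | #|P| == m) \sum_(i in P) F (S P + X i) =
      \sum_(P : {set I} | #|P| == m) \sum_(j | j \notin P)
        \sum_(i in P) F (S P + X i).
    rewrite mulr_sumr; apply: eq_bigr => P /eqP cP.
    rewrite sumr_const mulr_natl; congr (_ *+ _).
    by rewrite -cP /n -(cardC (mem P)) addKn; apply: eq_card => i.
  rewrite sum_insert_delete mulr_sumr; apply: ler_sum => Q /eqP cQ.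
  exact: jensen.
have -> : \sum_(P : {set I} | #|P| == m) \sum_i F (\sum_(i in P) X i + X i) =
    \sum_(P : {set I} | #|P| == m) \sum_(i in P) F (S P + X i) +
    \sum_(P : {set I} | #|P| == m) \sum_(j | j \notin P) F (S P + X j).
  by rewrite -big_split; apply: eq_bigr => P _; rewrite (bigID (mem P)).
rewrite mulrDr fresh.
have -> : (m.+1 * n)%:R * a = (m.+1 * m)%:R * a + (n - m)%:R * (m.+1%:R * a).
  by rewrite mulrA -mulrDl -natrM -natrD; congr (_%:R * _); nia.
by rewrite lerD2r.
Qed.

End WithoutReplacement.

(** * The trace potential along a sample *)

Section MatrixChernoff.
Variables (R : realFieldType) (d : nat) (I : finType) (Y : I -> 'M[R]_d).
Variables (l K : R) (N : nat).
Let n := #|I|.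
(* All matrices [K - S Q] are bounded below by [b I], since [S Q <= n l I]. *)
Let b := K - n%:R * l.
Let S (Q : {set I}) := \sum_(i in Q) Y i.
Let Phi (Z : 'M[R]_d) := \tr ((K%:M - Z) ^+ N.+2).
Hypotheses (l_gt0 : 0 < l) (b_gt0 : 0 < b).
Hypotheses (pY : forall i, psd (Y i)) (plY : forall i, psd (l%:M - Y i)).
Hypothesis meanY : \sum_i Y i = n%:R%:M.

Let psd_margin Q : psd (K%:M - S Q - b%:M).
Proof.
have -> : K%:M - S Q - b%:M = \sum_(i in Q) (l%:M - Y i) + ((n - #|Q|)%:R * l)%:M.
  rewrite big_split /= sumrN sumr_const -[_%:M *+ _]raddfMn -/(S Q).
  rewrite natrB ?max_card // mulrBl /b addrAC -raddfB addrAC -raddfD /=.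
  by congr (_%:M - _); rewrite -mulr_natl; ring.
apply: psdD; first exact: psd_sum.
by apply: psd_scalar; rewrite mulr_ge0 // ltW.
Qed.

Let psd_slack Q : psd (K%:M - S Q).
Proof.
have := psdD (psd_margin Q) (psd_scalar d (ltW b_gt0)).
by rewrite subrK.
Qed.

Let Phi_ge0 Q : 0 <= Phi (S Q).
Proof.
rewrite /Phi -[X in \tr X]mulr1; apply: psd_tr_mul_ge0.
  exact/psd_exp/psd_slack.
exact: psd_scalar.
Qed.

(* Here [i] may lie in [P], so that the summands need not form a set. *)
Let psd_margin_add (P : {set I}) i : (#|P| < n)%N ->
  psd (K%:M - S P - Y i - b%:M).
Proof.
move=> ltPn.
have -> : K%:M - S P - Y i - b%:M =
    \sum_(i in P) (l%:M - Y i) + (l%:M - Y i) + ((n - #|P|.+1)%:R * l)%:M.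
  rewrite big_split /= sumrN sumr_const -[_%:M *+ _]raddfMn -/(S P).
  apply/matrixP => p q; rewrite !mxE natrB // mulrBl /b -natr1.
  rewrite -(mulr_natl l #|P|); move: (n%:R) (#|P|%:R) => x y.
  by case: (p == q); rewrite ?mulr1n ?mulr0n; ring.
apply: psdD; last by apply: psd_scalar; rewrite mulr_ge0 // ltW.
by apply: psdD => //; apply: psd_sum.
Qed.

(** The linear terms [Y j - Y i] of the supporting hyperplanes cancel over all
    ordered pairs in [Q]. *)
Let potential_swap (Q : {set I}) m : #|Q| = m.+1 ->
  (m.+1 * m)%:R * Phi (S Q) <=
  \sum_(j in Q) \sum_(i in Q :\ j) Phi (S (Q :\ j) + Y i).
Proof.
move=> cQ; set B := K%:M - S Q.
have cQj j : j \in Q -> #|Q :\ j| = m.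
  by move=> jQ; move: cQ; rewrite (cardsD1 j) jQ => -[].
have card_pairs : (m.+1 * m)%:R * Phi (S Q) =
    \sum_(j in Q) \sum_(i in Q :\ j) Phi (S Q).
  under eq_bigr => j jQ do rewrite sumr_const cQj //.
  by rewrite sumr_const cQ -mulrnA mulr_natl mulnC.
rewrite card_pairs -subr_ge0 -sumrB.
under eq_bigr => j _ do rewrite -sumrB.
have grad j i : j \in Q ->
    N.+2%:R * \tr ((Y j - Y i) * B ^+ N.+1) <= Phi (S (Q :\ j) + Y i) - Phi (S Q).
  move=> jQ; rewrite /Phi.
  have SQ : S Q = Y j + S (Q :\ j) by rewrite /S (big_setD1 j).
  have pA : psd (K%:M - (S (Q :\ j) + Y i)).
    have := psdD (@psd_margin_add (Q :\ j) i _) (psd_scalar d (ltW b_gt0)).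
    by rewrite subrK opprD addrA; apply; rewrite cQj // -cQ max_card.
  have := tr_exp_gradient_le (psd_slack Q) pA N.+1.
  rewrite -/B; congr (_ * \tr (_ * _) <= _); rewrite /B SQ !opprD.
  by apply/matrixP => p q; rewrite !mxE; ring.
apply: le_trans (_ : \sum_(j in Q) \sum_(i in Q :\ j)
   N.+2%:R * \tr ((Y j - Y i) * B ^+ N.+1) <= _); last first.
  by apply: ler_sum => j jQ; apply: ler_sum => i _; apply: grad.
have -> : \sum_(j in Q) \sum_(i in Q :\ j)
      N.+2%:R * \tr ((Y j - Y i) * B ^+ N.+1) =
    \sum_(j in Q) \sum_(i in Q) N.+2%:R * \tr ((Y j - Y i) * B ^+ N.+1).
  apply: eq_bigr => j jQ; rewrite [RHS](big_setD1 j) //=.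
  by rewrite (subrr (Y j)) mul0r raddf0 mulr0 add0r.
under eq_bigr => j _.
  rewrite -mulr_sumr -raddf_sum -mulr_suml sumrB sumr_const -/(S Q); over.
rewrite -mulr_sumr -raddf_sum -mulr_suml sumrB sumr_const -sumrMnl -/(S Q) subrr.
by rewrite mul0r raddf0 mulr0.
Qed.

(** The factor that one draw contributes to the mean potential.  For
    [K = N / theta] with [N] large it is close to
    [1 - theta (1 - theta l / 2)]. *)
Definition chernoff_factor := 1 - N.+2%:R * (1 - N.+1%:R * l / (2 * b)) / K.

Hypothesis c_ge0 : 0 <= 1 - N.+1%:R * l / (2 * b).

Let K_gt0 : 0 < K.
Proof.
have : 0 <= n%:R * l by rewrite mulr_ge0 // ltW.
by move: b_gt0; rewrite /b; lra.
Qed.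

(** Since the mean of the [Y i] is [I], the first-order terms average to
    [tr B^(N+1)], which is at least [tr B^(N+2) / K] because [B <= K I]. *)
Let potential_average (P : {set I}) : (#|P| < n)%N ->
  \sum_i Phi (S P + Y i) <= n%:R * (chernoff_factor * Phi (S P)).
Proof.
move=> ltPn; rewrite /Phi; set B := K%:M - S P.
have c0 := c_ge0; set c := 1 - _ in c0.
have step i : \tr ((K%:M - (S P + Y i)) ^+ N.+2) <=
    \tr (B ^+ N.+2) - N.+2%:R * c * \tr (Y i * B ^+ N.+1).
  by rewrite opprD addrA; apply: tr_exp_sub_le => //; apply: psd_margin_add.
apply: le_trans (ler_sum _ (fun i _ => step i)) _.
rewrite sumrB sumr_const -mulr_sumr -raddf_sum -mulr_suml meanY -/n /=.
have -> : \tr (n%:R%:M * B ^+ N.+1) = n%:R * \tr (B ^+ N.+1).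
  by rewrite -mulmxE mul_scalar_mx mxtraceZ.
rewrite -[X in X - _]mulr_natl /chernoff_factor -/c.
have : 0 <= \tr ((K%:M - B) * B ^+ N.+1).
  apply: psd_tr_mul_ge0; last exact/psd_exp/psd_slack.
  by rewrite /B opprB addrC subrK; apply: psd_sum.
have -> : \tr ((K%:M - B) * B ^+ N.+1) = K * \tr (B ^+ N.+1) - \tr (B ^+ N.+2).
  by rewrite mulrBl raddfB /= -exprS -mulmxE mul_scalar_mx mxtraceZ.
rewrite subr_ge0 => leK.
set u := \tr (B ^+ N.+2) in leK *; set w := \tr _ in leK *.
have -> : n%:R * u - N.+2%:R * c * (n%:R * w) = n%:R * (u - N.+2%:R * c * w).
  by ring.
rewrite ler_wpM2l // mulrBl mul1r lerD2l lerN2.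
have -> : N.+2%:R * c / K * u = N.+2%:R * c * (u / K) by field; rewrite gt_eqF.
by rewrite ler_wpM2l ?mulr_ge0 // ler_pdivrMr // mulrC.
Qed.

(** The empty sample has potential [d K^(N+2)], and the binomial weights of
    [without_replacement_step] are those that turn sums over subsets of a given
    size into means. *)
Lemma potential_sum_le (q : R) m : 0 <= q -> chernoff_factor <= q -> (m <= n)%N ->
  \sum_(Q : {set I} | #|Q| == m) Phi (S Q) <=
  'C(n, m)%:R * (q ^+ m * (d%:R * K ^+ N.+2)).
Proof.
move=> q0 le_factor; elim: m => [_|m IH ltmn].
  rewrite (big_pred1 finset.set0); last by move=> Q; rewrite cards_eq0.
  rewrite /Phi /S big_set0 subr0 bin0 mul1r expr0 mul1r.
  suff -> : (K%:M : 'M[R]_d) ^+ N.+2 = (K ^+ N.+2)%:M.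
    by rewrite mxtrace_scalar mulr_natl.
  by rewrite rmorphXn.
have {IH} := IH (ltnW ltmn).
have := without_replacement_step ltmn (@potential_swap^~ m).
set a1 := \sum_(Q | _) _; set a0 := \sum_(Q | _) Phi _; set t := \sum_(P | _) _.
have : t <= n%:R * (q * a0).
  rewrite /t /a0 !mulr_sumr; apply: ler_sum => P /eqP cP.
  apply: le_trans (potential_average _) _; first by rewrite cP.
  by rewrite ler_wpM2l // ler_wpM2r.
have /(congr1 (fun k => k%:R : R)) := mul_bin_left n m; rewrite !natrM -/n.
set C1 := 'C(n, m.+1)%:R; set C0 := 'C(n, m)%:R; set r := (n - m)%:R.
set D := d%:R * _; move=> CE let_ lea1 lea0.
have n0 : 0 < n%:R :> R by rewrite ltr0n; apply: leq_ltn_trans ltmn.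
have r0 : 0 <= r by [].
rewrite -(ler_pM2l (_ : 0 < n%:R * m.+1%:R)) ?mulr_gt0 ?ltr0Sn //.
apply: le_trans (_ : r * (n%:R * (q * a0)) <= _).
  by apply: le_trans (ler_wpM2l r0 let_); rewrite [n%:R * _]mulrC.
have -> : n%:R * m.+1%:R * (C1 * (q ^+ m.+1 * D)) =
    r * (n%:R * (q * (C0 * (q ^+ m * D)))).
  transitivity (n%:R * (m.+1%:R * C1) * q * (q ^+ m * D)).
    by rewrite exprS; ring.
  by rewrite CE; ring.
by rewrite !ler_wpM2l // ltW.
Qed.

(** Markov's inequality: on a bad set the matrix [K - S Q] has a Rayleigh
    quotient of at least [K - tau], which forces a potential of at least
    [(K - tau)^(N+2)]. *)
Lemma matrix_chernoff_count (q tau : R) m (Bad : {set {set I}}) :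
  0 <= q -> chernoff_factor <= q -> (m <= n)%N -> tau <= K ->
  (forall Q, Q \in Bad -> #|Q| = m /\
     exists2 v : 'cV[R]_d, v != 0 &
       \tr (v^T *m S Q *m v) <= tau * \tr (v^T *m v)) ->
  #|Bad|%:R * (K - tau) ^+ N.+2 <= 'C(n, m)%:R * (q ^+ m * (d%:R * K ^+ N.+2)).
Proof.
move=> q0 le_factor lemn letau bad.
apply: le_trans (potential_sum_le q0 le_factor lemn).
rewrite mulr_natl -sumr_const [leRHS](bigID (mem Bad)) /=.
apply: ler_wpDr; first by apply: sumr_ge0.
rewrite [leRHS](eq_bigl [in Bad]) => [|Q]; last first.
  have [/bad [/eqP cQ _]|_] := boolP (Q \in Bad); last by rewrite andbF.
  by rewrite cQ.
apply: ler_sum => Q /bad [_ [v v0 tauv]].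
apply: (tr_exp_ge (v := v)) => //; first by rewrite subr_ge0.
rewrite mulmxBr mulmxBl mxtraceD raddfN /= mul_mx_scalar -scalemxAl mxtraceZ.
by rewrite mulrBl lerD2l lerN2.
Qed.

End MatrixChernoff.

(** * The lower tail of a sum of positive semidefinite matrices *)

Section LowerTail.
Variable R : realType.

(** As [exp (- s) >= 1 - s], the bound for [N] gives
    [p (1 - C / (N + 2)) <= A]. *)
Lemma le_of_le_expR_div (p A C X0 : R) : 0 <= p -> 0 <= C ->
  (forall N : nat, X0 <= N.+2%:R -> p <= A * expR (C / N.+2%:R)) -> p <= A.
Proof.
move=> p0 C0 H; apply/ler_addgt0Pr => e e0.
pose X := Num.max 0 (Num.max X0 (p * C / e)).
pose N := Num.bound X.
have XN : X <= N.+2%:R.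
  have X0' : 0 <= X by rewrite le_max lexx.
  apply: le_trans (ltW (archi_boundP X0')) _; rewrite ler_nat -/N.
  by rewrite -addn2 leq_addr.
have N0 : 0 < N.+2%:R :> R by rewrite ltr0Sn.
have X0N : X0 <= N.+2%:R by apply: le_trans XN; rewrite !le_max lexx !orbT.
have peN : p * C / e <= N.+2%:R by apply: le_trans XN; rewrite !le_max lexx !orbT.
set s := C / N.+2%:R.
have := H N X0N; rewrite -/s => pA.
have : p * (1 - s) <= A.
  apply: le_trans (_ : p * expR (- s) <= _).
    by rewrite ler_wpM2l // expR_ge1Dx.
  by rewrite expRN ler_pdivrMr ?expR_gt0.
have : p * s <= e.
  by rewrite mulrA ler_pdivrMr // [e * _]mulrC -ler_pdivrMr.
by lra.
Qed.

Lemma expR_le_1B (y : R) :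
  0 <= y -> y <= 1 / 2 -> expR (- (y * (1 + 2 * y))) <= 1 - y.
Proof.
move=> y0 y1; rewrite expRN invf_ple ?posrE ?expR_gt0 //; last by lra.
apply: le_trans (expR_ge1Dx _).
rewrite -[leLHS]mul1r ler_pdivrMr; last by lra.
nra.
Qed.

(** The counting bound is used with [theta = delta / l] and [K = (N+2) / theta].
    It then reads [|Bad| <= 'C(n, m) d exp (- m delta^2 / (2 l) + C / (N+2))]
    for a constant [C], and [N] is sent to infinity. *)
Lemma matrix_chernoff_lower_tail d (I : finType) (Y : I -> 'M[R]_d) (l delta : R)
    m (Bad : {set {set I}}) :
  0 < l -> 0 < delta -> delta <= 1 -> (m <= #|I|)%N ->
  (forall i, psd (Y i)) -> (forall i, psd (l%:M - Y i)) ->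
  \sum_i Y i = #|I|%:R%:M ->
  (forall Q, Q \in Bad -> #|Q| = m /\
     exists2 v : 'cV[R]_d, v != 0 &
       \tr (v^T *m (\sum_(i in Q) Y i) *m v) <=
       (1 - delta) * m%:R * \tr (v^T *m v)) ->
  #|Bad|%:R <= 'C(#|I|, m)%:R * (d%:R * expR (- (m%:R * delta ^+ 2 / (2 * l)))).
Proof.
move=> l0 dl0 dl1 lemn pY plY meanY bad; set n := #|I| in lemn meanY *.
pose theta := delta / l; pose u := (1 - delta) * m%:R * theta.
have th0 : 0 < theta by rewrite divr_gt0.
have dl1' : 0 <= 1 - delta by rewrite subr_ge0.
have u0 : 0 <= u := mulr_ge0 (mulr_ge0 dl1' (ler0n _ m)) (ltW th0).
(* Let [w = N + 2].  The two terms bound the errors, of order [1 / w], made when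
   [(1 - u / w)^w] is replaced by [exp (- u)] and when [w l / (2 b)] is replaced
   by [delta / 2].  For [w >= 2 n + 2 u] the ratios [u / w] and [n delta / w]
   are at most [1 / 2], where [1 / (1 - x) <= 1 + 2 x]. *)
pose C := 2 * u ^+ 2 + theta * m%:R * n%:R * delta ^+ 2.
apply: (@le_of_le_expR_div _ _ C (2 * n%:R + 2 * u)) => [//||N].
  apply: addr_ge0; first by rewrite mulr_ge0 // sqr_ge0.
  apply: mulr_ge0 (sqr_ge0 _); apply: mulr_ge0 => //.
  exact: mulr_ge0 (ltW th0) (ler0n _ m).
have [w wE] : {w : R | w = N.+2%:R} by exists N.+2%:R.
rewrite -wE => largeN; have w0 : 0 < w by rewrite wE ltr0Sn.
have n_ge0 : 0 <= n%:R :> R by [].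
pose K := w / theta; pose b := K - n%:R * l.
have bE : b = l / delta * (w - n%:R * delta).
  by rewrite /b /K /theta; field; rewrite !gt_eqF.
have wn : 0 < w - n%:R * delta by nra.
have b0 : 0 < b by rewrite bE mulr_gt0 // divr_gt0.
pose c' := 1 - delta / 2 - n%:R * delta ^+ 2 / w.
have c'_le : c' <= 1 - N.+1%:R * l / (2 * b).
  rewrite /c' -addrA -opprD lerD2l lerN2.
  apply: le_trans (_ : w * l / (2 * b) <= _).
    by rewrite ler_pM2r ?invr_gt0 ?mulr_gt0 // ler_pM2r // wE ler_nat.
  have -> : w * l / (2 * b) = w * delta / (2 * (w - n%:R * delta)).
    by rewrite bE; field; rewrite !gt_eqF.
  have -> : delta / 2 + n%:R * delta ^+ 2 / w =
            delta * (w + 2 * n%:R * delta) / (2 * w).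
    by field; rewrite gt_eqF.
  rewrite ler_pdivrMr ?mulr_gt0 // mulrAC ler_pdivlMr ?mulr_gt0 //.
  have h1 : 0 <= w - 2 * n%:R * delta by nra.
  have h2 : 0 <= n%:R * delta * (w - 2 * n%:R * delta).
    by rewrite !mulr_ge0 // ltW.
  have h3 : 0 <= delta * (n%:R * delta * (w - 2 * n%:R * delta)).
    by rewrite mulr_ge0 // ltW.
  nra.
have c'0 : 0 <= c'.
  rewrite /c'; have : n%:R * delta ^+ 2 / w <= 1 / 2.
    rewrite ler_pdivrMr //; have : delta ^+ 2 <= 1 by rewrite expr_le1 // ltW.
    nra.
  lra.
have c0 := le_trans c'0 c'_le.
pose q := expR (- (theta * c')).
have qle : chernoff_factor I l K N <= q.
  rewrite /chernoff_factor -/n -/b -wE.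
  apply: le_trans (expR_ge1Dx _); rewrite lerD2l lerN2.
  have -> : w * (1 - N.+1%:R * l / (2 * b)) / K =
            theta * (1 - N.+1%:R * l / (2 * b)).
    by rewrite /K; field; rewrite !gt_eqF.
  by rewrite ler_pM2l.
pose tau := (1 - delta) * m%:R.
pose y := u / w.
have y0 : 0 <= y by rewrite divr_ge0 // ltW.
have y1 : y <= 1 / 2 by rewrite ler_pdivrMr //; lra.
have K0 : 0 < K by rewrite divr_gt0.
have Ktau : K - tau = K * (1 - y).
  by rewrite /K /y /u /tau; field; rewrite !gt_eqF.
have tauK : tau <= K by rewrite -subr_ge0 Ktau mulr_ge0 ?(ltW K0) //; lra.
have := @matrix_chernoff_count R d I Y l K N l0 b0 pY plY meanY c0 q tau m Bad
  (expR_ge0 _) qle lemn tauK bad.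
rewrite -/n Ktau exprMn.
have -> : #|Bad|%:R * (K ^+ N.+2 * (1 - y) ^+ N.+2) =
  (#|Bad|%:R * (1 - y) ^+ N.+2) * K ^+ N.+2.
  by ring.
have -> : 'C(n, m)%:R * (q ^+ m * (d%:R * K ^+ N.+2)) =
  ('C(n, m)%:R * (q ^+ m * d%:R)) * K ^+ N.+2 by ring.
rewrite ler_pM2r ?exprn_gt0 // => main.
have yN : expR (- (u * (1 + 2 * y))) <= (1 - y) ^+ N.+2.
  have -> : - (u * (1 + 2 * y)) = N.+2%:R * - (y * (1 + 2 * y)).
    by rewrite -wE /y; field; rewrite gt_eqF.
  by rewrite expRM_natl lerXn2r ?nnegrE ?expR_ge0 ?expR_le_1B //; lra.
have {yN} : #|Bad|%:R * expR (- (u * (1 + 2 * y))) <=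
    'C(n, m)%:R * (q ^+ m * d%:R).
  by apply: le_trans main; rewrite ler_wpM2l.
move=> le_bad; rewrite expRN ler_pdivrMr ?expR_gt0 // in le_bad.
apply: le_trans le_bad _.
rewrite /q -expRM_natl.
have -> : 'C(n, m)%:R * (expR (m%:R * - (theta * c')) * d%:R) *
    expR (u * (1 + 2 * y)) =
  'C(n, m)%:R * d%:R * expR (m%:R * - (theta * c') + u * (1 + 2 * y)).
  by rewrite expRD; ring.
rewrite [leRHS](_ : _ = 'C(n, m)%:R * d%:R *
  expR (- (m%:R * delta ^+ 2 / (2 * l)) + C / w)); last by rewrite expRD; ring.
suff -> : m%:R * - (theta * c') + u * (1 + 2 * y) =
    - (m%:R * delta ^+ 2 / (2 * l)) + C / w by [].
rewrite /c' /C /y /u /theta; field; rewrite !gt_eqF //.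
Qed.

End LowerTail.

(** * From counting sets to probabilities *)

Section UniformSampling.
Variables (R : realType) (disp : measure_display) (T : measurableType disp).
Variable P : probability T R.

Lemma measure_fibers (J : eqType) (S : T -> J) (s : seq J) :
  uniq s -> (forall f, measurable [set w | S w = f]%classic) ->
  measurable [set w | S w \in s]%classic /\
  P [set w | S w \in s]%classic = (\sum_(f <- s) P [set w | S w = f]%classic)%E.
Proof.
move=> us mS; elim: s us => [_|f s IH /= /andP[fs us]].
  have -> : [set w | S w \in [::]]%classic = set0 by apply/seteqP; split.
  by rewrite big_nil measure0.
have [ms Ps] := IH us.
have -> : [set w | S w \in f :: s]%classic =
   ([set w | S w = f] `|` [set w | S w \in s])%classic.
  by apply/seteqP; split=> w /=; rewrite inE => /predU1P.
split; first exact: measurableU.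
rewrite big_cons -Ps measureU //.
by apply/seteqP; split => // w [/= -> /(negP fs)].
Qed.

(** An injective sequence of length [m] with values in a set of size [m] has
    that set as its image, so that the image [Q] arises from [m ^_ m = m!]
    sequences. *)
Lemma card_inj_image n m (A : {set {set 'I_n}}) :
  (forall Q, Q \in A -> #|Q| = m) ->
  #|[set f : {ffun 'I_m -> 'I_n} | injectiveb f & f @: 'I_m \in A]%SET| =
  (#|A| * m`!)%N.
Proof.
move=> cA; rewrite -sum1_card.
rewrite (partition_big (fun f : {ffun 'I_m -> 'I_n} => f @: 'I_m) [in A]);
  last first.
  by move=> f; rewrite inE => /andP[].
rewrite -sum_nat_const; apply: eq_bigr => Q QA; rewrite sum1_card.
have cQ : #|Q| = #|'I_m| by rewrite cA // card_ord.
rewrite -[m in RHS](card_ord m) -(ffactnn #|'I_m|) -[X in (X ^_ _)%N]cQ.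
rewrite -card_inj_ffuns_on; apply: eq_card => f; rewrite !inE unfold_in /= inE.
have [/injectiveP injf|] := boolP (injectiveb f); last by rewrite andbF.
rewrite /= andbT; apply/andP/ffun_onP => [[_ /eqP <-] i|fQ]; first exact: imset_f.
suff fE : f @: 'I_m = Q by rewrite fE QA eqxx.
apply/eqP; rewrite eqEcard card_imset // card_ord (cA Q QA) leqnn andbT.
by apply/fintype.subsetP => _ /imsetP[i _ ->].
Qed.

(** Only the sequences in [E] that are injective with an image outside [Bad]
    are counted: they already have total mass [1 - |Bad| / 'C(n, m)]. *)
Lemma sample_without_replacement_ge m n (S : T -> {ffun 'I_m -> 'I_n})
    (Bad : {set {set 'I_n}}) (p : R) :
  (m <= n)%N -> uniform_sample_without_replacement P S ->
  (forall Q, Q \in Bad -> #|Q| = m) -> #|Bad|%:R <= 'C(n, m)%:R * p ->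
  forall E : {pred {ffun 'I_m -> 'I_n}},
  (forall f : {ffun 'I_m -> 'I_n},
     injective f -> f @: 'I_m \notin Bad -> f \in E) ->
  ((1 - p)%:E <= P [set w | S w \in E]%classic)%E.
Proof.
move=> lemn [mS uS] cBad leBad E goodE.
pose A := ([set Q : {set 'I_n} | #|Q| == m] :\: Bad)%SET.
pose G := [set f : {ffun 'I_m -> 'I_n} | injectiveb f & f @: 'I_m \in A]%SET.
have GE f : f \in G -> f \in E.
  rewrite !inE => /andP[/injectiveP injf /andP[nB _]]; exact: goodE.
have cG : #|G| = (#|A| * m`!)%N.
  by apply: card_inj_image => Q; rewrite !inE => /andP[_ /eqP].
have cA : #|A| = ('C(n, m) - #|Bad|)%N.
  rewrite cardsD card_draws card_ord; congr (_ - _)%N; apply: eq_card => Q.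
  by rewrite !inE; case: (boolP (Q \in Bad)) => [/cBad ->|]; rewrite ?eqxx ?andbF.
have [mG PG] := measure_fibers (enum_uniq G) mS.
have [mE _] := measure_fibers (enum_uniq E) mS.
have EE : [set w | S w \in E]%classic = [set w | S w \in enum E]%classic.
  by apply/seteqP; split=> w /=; rewrite mem_enum.
apply: (@le_trans _ _ (P [set w | S w \in enum G]%classic)); last first.
  rewrite EE; apply: le_measure; rewrite ?inE //.
  by move=> w /=; rewrite !mem_enum; apply: GE.
rewrite PG (eq_big_seq (fun=> ((n ^_ m)%:R^-1)%:E)); last first.
  by move=> f; rewrite mem_enum inE => /andP[/injectiveP injf _]; apply: uS.
rewrite sumEFin lee_fin big_const_seq count_predT -cardE iter_addr_0 cG cA.
rewrite -[_ *+ (_ * _)]mulr_natl -bin_ffact.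
have C0 : 0 < 'C(n, m)%:R :> R by rewrite ltr0n bin_gt0.
have f0 : 0 < m`!%:R :> R by rewrite ltr0n fact_gt0.
rewrite !natrM -(ler_pM2l C0) natrB; last first.
  rewrite -[X in 'C(X, _)]card_ord -card_draws; apply: subset_leq_card.
  by apply/fintype.subsetP => Q /cBad cQ; rewrite inE cQ.
set x := #|Bad|%:R in leBad *.
have -> : 'C(n, m)%:R * (('C(n, m)%:R - x) * m`!%:R / ('C(n, m)%:R * m`!%:R)) =
   'C(n, m)%:R - x by field; rewrite !gt_eqF.
by rewrite mulrBr mulr1 lerD2l lerN2.
Qed.

End UniformSampling.

(** * Whitening of the data *)

Section Whitening.
Variable R : realType.

(** Put [y = H^-1 x] and [z = G^-1 y].  The quantity [q = x^T H^-1 x] equals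
    both [z^T (G^T H G) z >= k |z|^2] and [(G^T x)^T z], and Cauchy-Schwarz
    gives [q^2 <= |G^T x|^2 |z|^2 <= |G^T x|^2 q / k]. *)
Lemma quad_invmx_le d (H G : 'M[R]_d) (x : 'cV[R]_d) (k : R) :
  H^T = H -> 0 < k -> G \in unitmx ->
  (forall z : 'cV[R]_d,
     k * \tr (z^T *m z) <= \tr (z^T *m (G^T *m H *m G) *m z)) ->
  \tr (x^T *m invmx H *m x) <= \tr ((G^T *m x)^T *m (G^T *m x)) / k.
Proof.
move=> sH k0 uG coercive; set a := G^T *m x.
have uH : H \in unitmx.
  rewrite -row_free_unit; apply: inj_row_free => y yH0.
  have [z yE] : exists z, y^T = G *m z.
    by exists (invmx G *m y^T); rewrite mulKVmx.
  have : \tr (z^T *m z) = 0.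
    apply/eqP; rewrite eq_le tr_mulT_ge0 andbT -(ler_pM2l k0) mulr0.
    apply: le_trans (coercive z) _.
    have -> : z^T *m (G^T *m H *m G) *m z = y *m H *m y^T.
      have yE' : y = z^T *m G^T by rewrite -trmx_mul -yE trmxK.
      by rewrite !mulmxA -yE' -[_ *m G *m z]mulmxA -yE.
    by rewrite yH0 mul0mx mxtrace0.
  rewrite tr_col_sqr => /psumr_eq0P z0.
  apply: trmx_inj; rewrite yE trmx0; suff -> : z = 0 by rewrite mulmx0.
  apply/colP => i; rewrite [RHS]mxE; apply/eqP; rewrite -sqrf_eq0; apply/eqP.
  by apply: z0 => // j _; apply: sqr_ge0.
have [y xE] : exists y, x = H *m y by exists (invmx H *m x); rewrite mulKVmx.
have [z yE] : exists z, y = G *m z by exists (invmx G *m y); rewrite mulKVmx.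
have Hx : invmx H *m x = y by rewrite xE mulKmx.
set q := \tr (x^T *m invmx H *m x).
have qa : q = \tr (a^T *m 1%:M *m z).
  by rewrite mulmx1 /a trmx_mul trmxK -mulmxA -yE /q -mulmxA Hx.
have qz : k * \tr (z^T *m z) <= q.
  suff -> : q = \tr (z^T *m (G^T *m H *m G) *m z) by [].
  have -> : z^T *m (G^T *m H *m G) *m z = y^T *m H *m y.
    have yE' : y^T = z^T *m G^T by rewrite -trmx_mul -yE.
    by rewrite !mulmxA -yE' -[_ *m G *m z]mulmxA -yE.
  by rewrite -mulmxA -xE -mxtrace_tr trmx_mul trmxK /q -mulmxA Hx.
have := psd_cauchy_schwarz a z (psd_scalar d ler01).
rewrite -qa !mulmx1; set A := \tr (a^T *m a); set Z := \tr (z^T *m z) in qz *.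
have A0 : 0 <= A := tr_mulT_ge0 a.
have Z0 : 0 <= Z := tr_mulT_ge0 z.
move=> cs; rewrite ler_pdivlMr //.
have [q0|q0] := leP q 0; first by apply: le_trans A0; rewrite mulr_le0_ge0 // ltW.
rewrite -(ler_pM2l q0).
apply: le_trans (_ : A * Z * k <= _); first by rewrite mulrA -expr2 ler_pM2r.
by rewrite -mulrA mulrC ler_wpM2r // mulrC.
Qed.

Variables (d n : nat) (x : 'I_n -> 'cV[R]_d).
Variables (U : 'M[R]_d) (sigma : 'rV[R]_d) (V : 'M[R]_(n, d)) (rho : R).
Hypothesis svdX : is_svd ((Num.sqrt n%:R)^-1 *: data_mx x) U sigma V.
Hypotheses (n_gt0 : (0 < n)%N) (rho_gt0 : 0 < rho).

Let sqrt_n_gt0 : 0 < Num.sqrt n%:R :> R.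
Proof. by rewrite sqrtr_gt0 ltr0n. Qed.

Let shift_gt0 j : 0 < sigma 0 j ^+ 2 + rho.
Proof. by rewrite ltr_wpDl // sqr_ge0. Qed.

Definition scaling_row : 'rV[R]_d := \row_j (Num.sqrt (sigma 0 j ^+ 2 + rho))^-1.
Definition whitening : 'M[R]_d := U *m diag_mx scaling_row.
Definition whitened (i : 'I_n) : 'M[R]_d :=
  whitening^T *m (x i *m (x i)^T + rho%:M) *m whitening.

Let G := whitening.
Let D := diag_mx scaling_row.
Let Sg := diag_mx sigma.

Let scaling_sqr j : scaling_row 0 j ^+ 2 = (sigma 0 j ^+ 2 + rho)^-1.
Proof. by rewrite mxE exprVn sqr_sqrtr // ltW. Qed.

Let data_svd : data_mx x = Num.sqrt n%:R *: (U *m Sg *m V^T).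
Proof. by rewrite -(svd_factorization svdX) scalerA mulfV ?scale1r // gt_eqF. Qed.

(** In the basis [U] the regularized covariance is [Sg^2 + rho I]. *)
Let scaling_whitens : D *m (Sg *m Sg + rho%:M) *m D = 1%:M.
Proof.
rewrite /D /Sg -(diag_const_mx _ rho) mulmx_diag -raddfD /= !mulmx_diag.
rewrite -diag_const_mx; congr diag_mx; apply/rowP => j; rewrite !mxE.
have s2 := sqr_sqrtr (ltW (shift_gt0 j)).
have s0 : Num.sqrt (sigma 0 j ^+ 2 + rho) != 0 by rewrite gt_eqF // sqrtr_gt0.
move: (Num.sqrt _) s2 s0 => s s2 s0.
by rewrite -[sigma 0 j * _]expr2 -s2; field.
Qed.

Let UtU : U^T *m U = 1%:M := svd_left_orthogonal svdX.

Lemma whitening_unit : G \in unitmx.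
Proof.
rewrite unitmx_mul; apply/andP; split; first by have [_] := mulmx1_unit UtU.
have [] := @mulmx1_unit _ _ D ((Sg *m Sg + rho%:M) *m D) => //.
by rewrite mulmxA scaling_whitens.
Qed.

Let gramG : G^T *m G = D *m D.
Proof.
by rewrite trmx_mul tr_diag_mx mulmxA -[_ *m U^T *m U]mulmxA UtU mulmx1.
Qed.

Lemma sum_outer_data :
  \sum_i x i *m (x i)^T = n%:R *: (U *m (Sg *m Sg) *m U^T).
Proof.
have -> : \sum_i x i *m (x i)^T = data_mx x *m (data_mx x)^T.
  apply/matrixP => p q; rewrite summxE mxE; apply: eq_bigr => i _.
  by rewrite !mxE big_ord1 !mxE.
rewrite data_svd linearZ /= -scalemxAl -scalemxAr scalerA -expr2 sqr_sqrtr //.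
congr (_ *: _); rewrite !trmx_mul trmxK tr_diag_mx !mulmxA.
by rewrite -[_ *m V^T *m V]mulmxA (svd_right_orthonormal svdX) mulmx1.
Qed.

Lemma whitened_mean : \sum_i whitened i = n%:R%:M.
Proof.
rewrite /whitened -mulmx_suml -mulmx_sumr big_split /= sum_outer_data.
rewrite sumr_const card_ord -[_%:M *+ n]scaler_nat -scalerDr.
rewrite -scalemxAr -scalemxAl -[RHS]scalemx1; congr (_ *: _).
rewrite mulmxDr mulmxDl mul_mx_scalar -scalemxAl gramG.
rewrite -/G /G /whitening trmx_mul tr_diag_mx -/D !mulmxA.
rewrite -[_ *m U^T *m U]mulmxA UtU mulmx1.
rewrite -[_ *m U^T *m U]mulmxA UtU mulmx1.
by rewrite -[RHS]scaling_whitens mulmxDr mulmxDl mul_mx_scalar -scalemxAl !mulmxA.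
Qed.

Lemma whitened_psd i : psd (whitened i).
Proof.
apply: psd_congr; apply: psdD; last by apply: psd_scalar; apply: ltW.
by have := psd_congr (x i)^T (psd_scalar 1 ler01); rewrite trmxK mulmx1; apply.
Qed.

Lemma whitened_leverage i :
  \tr ((G^T *m x i)^T *m (G^T *m x i)) =
  n%:R * \sum_(j < d) sigma 0 j ^+ 2 / (sigma 0 j ^+ 2 + rho) * V i j ^+ 2.
Proof.
have -> : x i = col i (data_mx x) by apply/colP => k; rewrite !mxE.
rewrite data_svd tr_col_sqr mulr_sumr; apply: eq_bigr => j _.
have -> : G^T *m col i (Num.sqrt n%:R *: (U *m Sg *m V^T)) =
    Num.sqrt n%:R *: (D *m (Sg *m col i V^T)).
  rewrite !colE -scalemxAl -scalemxAr trmx_mul tr_diag_mx; congr (_ *: _).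
  by rewrite !mulmxA -[_ *m U^T *m U]mulmxA UtU mulmx1.
rewrite mxE mul_diag_mx mxE mul_diag_mx mxE [col _ _ _ _]mxE [_^T _ _]mxE.
by rewrite !exprMn sqr_sqrtr // scaling_sqr; ring.
Qed.

Let whitenedE i :
  whitened i = (G^T *m x i) *m (G^T *m x i)^T + rho *: (D *m D).
Proof.
rewrite /whitened -/G mulmxDr mulmxDl mul_mx_scalar -scalemxAl gramG.
by rewrite (trmx_mul G^T) trmxK !mulmxA.
Qed.

(** The matrix splits as [(L I - a a^T) + (I - rho D^2)] with [a = G^T x_i].
    The first part is positive semidefinite because [|a|^2 <= L], and the
    second one equals [D Sg^2 D]. *)
Lemma whitened_le (L : R) i :
  n%:R * \sum_(j < d) sigma 0 j ^+ 2 / (sigma 0 j ^+ 2 + rho) * V i j ^+ 2 <= L ->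
  psd ((L + 1)%:M - whitened i).
Proof.
rewrite -whitened_leverage; set a := G^T *m x i => leL.
have ridge : 1%:M - rho *: (D *m D) = (Sg *m D)^T *m 1%:M *m (Sg *m D).
  rewrite mulmx1; have := scaling_whitens.
  rewrite mulmxDr mulmxDl mul_mx_scalar -scalemxAl => <-.
  by rewrite addrK trmx_mul !tr_diag_mx !mulmxA.
rewrite whitenedE -/a raddfD opprD addrACA [X in _ + X]ridge.
apply: psdD; last by apply: psd_congr; apply: psd_scalar.
split=> [|v]; first by rewrite linearB /= tr_scalar_mx trmx_mul trmxK.
have -> : \tr (v^T *m (L%:M - a *m a^T) *m v) =
    L * \tr (v^T *m v) - \tr (a^T *m 1%:M *m v) ^+ 2.
  rewrite mulmxBr mulmxBl raddfB /= mul_mx_scalar -scalemxAl mxtraceZ mulmx1.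
  congr (_ - _); rewrite mulmxA -mulmxA tr_mx11_mul expr2; congr (_ * _).
  by rewrite -mxtrace_tr trmx_mul trmxK.
rewrite subr_ge0; apply: le_trans (psd_cauchy_schwarz a v (psd_scalar d ler01)) _.
by rewrite !mulmx1 ler_wpM2r // tr_mulT_ge0.
Qed.

(** When the numerical rank vanishes, every ratio
    [sigma_j^2 / (sigma_j^2 + rho)] does, so that both sides are [0]. *)
Lemma leverage_le_incoherence i :
  n%:R * \sum_(j < d) sigma 0 j ^+ 2 / (sigma 0 j ^+ 2 + rho) * V i j ^+ 2 <=
  incoherence sigma V rho * numerical_rank sigma rho.
Proof.
have ratio_ge0 j : 0 <= sigma 0 j ^+ 2 / (sigma 0 j ^+ 2 + rho).
  by rewrite divr_ge0 ?sqr_ge0 // ltW.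
set s := \sum_(j < d) _ * _.
have : 0 <= numerical_rank sigma rho by apply: sumr_ge0.
rewrite le_eqVlt => /predU1P[g0|g0].
  suff -> : s = 0 by rewrite -g0 !mulr0.
  rewrite /s big1 // => j _.
  have /psumr_eq0P -> // : numerical_rank sigma rho = 0 by [].
  by rewrite mul0r.
rewrite -ler_pdivrMr // mulrAC.
exact: (le_bigmax _ (fun i => n%:R / numerical_rank sigma rho *
  \sum_(j < d) sigma 0 j ^+ 2 / (sigma 0 j ^+ 2 + rho) * V i j ^+ 2)).
Qed.

Lemma whitened_hessian m (f : {ffun 'I_m -> 'I_n}) : (0 < m)%N -> injective f ->
  G^T *m sample_hessian rho (fun k => x (f k)) *m G =
  m%:R^-1 *: \sum_(i in f @: 'I_m) whitened i.
Proof.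
move=> m0 injf; rewrite /sample_hessian big_imset /=; last first.
  by move=> ? ? _ _; apply: injf.
rewrite /whitened -mulmx_suml -mulmx_sumr scalemxAl scalemxAr.
congr (_ *m _ *m _); rewrite big_split /= sumr_const card_ord scalerDr.
rewrite -[_%:M *+ m]scaler_nat scalerA mulVf ?pnatr_eq0 -?lt0n //.
by rewrite scale1r addrC.
Qed.

End Whitening.

(** * Leverage scores with respect to the sampled Hessian *)

Local Open Scope classical_set_scope.
Local Open Scope ring_scope.

Theorem theorem6 (R : realType) (disp : measure_display)
    (T : measurableType disp) (P : probability T R)
    (d n m : nat) (x : 'I_n -> 'cV[R]_d)
    (U : 'M[R]_d) (sigma : 'rV[R]_d) (V : 'M[R]_(n, d))
    (S : T -> {ffun 'I_m -> 'I_n}) (lambda beta delta t : R)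
    (x_neq0 : exists i, x i != 0)
    (le_d_n : (d <= n)%N)
    (svdX : is_svd ((Num.sqrt n%:R)^-1 *: data_mx x) U sigma V)
    (lambda_gt0 : 0 < lambda) (beta_gt0 : 0 < beta)
    (m_gt0 : (1 <= m)%N) (le_m_n : (m <= n)%N)
    (unifS : uniform_sample_without_replacement P S)
    (delta_gt0 : 0 < delta) (delta_le : delta <= 1 / 2)
    (t_gt0 : 0 < t) :
  let rho : R := n%:R * lambda / (m%:R * beta) in
  let mu : R := incoherence sigma V rho in
  let gamma : R := numerical_rank sigma rho in
  2 / delta ^+ 2 * (mu * gamma + 1) * (t + ln d%:R) <= m%:R ->
  ((1 - expR (- t))%:E <=
   P [set w | forall i : 'I_n,
        (((x i)^T *m invmx (sample_hessian rho (fun k => x (S w k))) *m x i) 0 0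
         <= (1 + 2 * delta) * mu * gamma)%R])%E.
Proof.
move=> rho mu gamma large.
have [i0 xi0] := x_neq0.
have n0 : (0 < n)%N by apply: leq_ltn_trans (ltn_ord i0).
have d0 : (0 < d)%N.
  rewrite lt0n; apply: contra_neq xi0 => d0; apply/colP => k.
  by have := ltn_ord k; rewrite {2}d0.
have nR : 0 < n%:R :> R by rewrite ltr0n.
have mR : 0 < m%:R :> R by rewrite ltr0n.
have rho0 : 0 < rho by rewrite divr_gt0 ?mulr_gt0.
pose G := whitening U sigma rho.
pose Y := whitened x U sigma rho.
pose L := mu * gamma.
have leL i := leverage_le_incoherence sigma V rho0 i.
have L0 : 0 <= L.
  apply: le_trans (leL i0).
  by rewrite -(whitened_leverage svdX n0 rho0) tr_mulT_ge0.
have L1 : 0 < L + 1 by rewrite ltr_wpDl.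
(* The sets for which the mean of the whitened samples has a Rayleigh quotient
   of at most [1 - delta]. *)
pose slow (Q : {set 'I_n}) := exists2 v : 'cV[R]_d, v != 0 &
  \tr (v^T *m (\sum_(i in Q) Y i) *m v) <= (1 - delta) * m%:R * \tr (v^T *m v).
pose Bad := finset (fun Q : {set 'I_n} => (#|Q| == m) && `[< slow Q >]).
have BadP Q : Q \in Bad -> #|Q| = m /\ slow Q.
  by rewrite inE => /andP[/eqP cQ /asboolP].
have delta1 : delta < 1 by lra.
have few : #|Bad|%:R <= 'C(n, m)%:R * expR (- t).
  have := @matrix_chernoff_lower_tail R d 'I_n Y (L + 1) delta m Bad L1 delta_gt0
    (ltW delta1).
  rewrite card_ord => /(_ le_m_n (whitened_psd _ _ _ rho0)) H.
  apply: le_trans (H _ _ BadP) _ => {H}.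
  - by move=> i; apply: (whitened_le svdX n0 rho0 (leL i)).
  - exact: (whitened_mean svdX n0 rho0).
  rewrite ler_wpM2l //.
  have dR : 0 < d%:R :> R by rewrite ltr0n.
  (* With [d = exp (ln d)] the condition on [m] becomes a bound on exponents. *)
  rewrite -{1}[d%:R]lnK ?posrE // -expRD ler_expR.
  suff : t + ln d%:R <= m%:R * delta ^+ 2 / (2 * (L + 1)) by lra.
  rewrite ler_pdivlMr ?mulr_gt0 // -ler_pdivrMr ?exprn_gt0 //.
  apply: le_trans large; rewrite le_eqVlt; apply/orP; left; apply/eqP.
  by rewrite /L; field; rewrite gt_eqF.
pose good (f : {ffun 'I_m -> 'I_n}) := forall i : 'I_n,
  ((x i)^T *m invmx (sample_hessian rho (fun k => x (f k))) *m x i) 0 0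
     <= (1 + 2 * delta) * mu * gamma.
pose E : {pred {ffun 'I_m -> 'I_n}} := fun f => `[< good f >].
have -> : [set w | forall i : 'I_n,
    ((x i)^T *m invmx (sample_hessian rho (fun k => x (S w k))) *m x i) 0 0
      <= (1 + 2 * delta) * mu * gamma] = [set w | S w \in E].
  by apply/seteqP; split=> w /asboolP.
apply: (sample_without_replacement_ge le_m_n unifS _ few) =>
  [Q /BadP[] //|f injf fBad].
apply/asboolP => i; rewrite -trace_mx11.
have coercive (z : 'cV[R]_d) : (1 - delta) * \tr (z^T *m z) <=
    \tr (z^T *m (G^T *m sample_hessian rho (fun k => x (f k)) *m G) *m z).
  rewrite whitened_hessian // -scalemxAr -scalemxAl mxtraceZ -/Y.
  have [->|z0] := eqVneq z 0; first by rewrite !mulmx0 !mxtrace0 !mulr0.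
  rewrite ler_pdivlMl // mulrA [m%:R * _]mulrC leNgt; apply/negP => slow_z.
  case/negP: fBad; rewrite inE card_imset // card_ord eqxx /=.
  by apply/asboolP; exists z => //; apply: ltW.
have sH : (sample_hessian rho (fun k => x (f k)))^T =
    sample_hessian rho (fun k => x (f k)).
  rewrite /sample_hessian linearD linearZ /= tr_scalar_mx linear_sum /=.
  by under eq_bigr do rewrite trmx_mul trmxK.
have uG : G \in unitmx := whitening_unit svdX rho0.
have dl : 0 < 1 - delta by lra.
apply: le_trans (quad_invmx_le (x i) sH dl uG coercive) _.
rewrite ler_pdivrMr // (whitened_leverage svdX n0 rho0); apply: le_trans (leL i) _.
have -> : (1 + 2 * delta) * mu * gamma * (1 - delta) =
    L * ((1 + 2 * delta) * (1 - delta)).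
  by rewrite /L; ring.
(* [(1 + 2 delta) (1 - delta) = 1 + delta (1 - 2 delta)] is at least [1]
   because [delta <= 1 / 2]. *)
rewrite -[leLHS]mulr1 ler_wpM2l //; nra.
Qed.
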